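(* Let $M,N,L$ be positive integers and let $\Psi\in\mathbb{R}^{N\times L}$ have rank $\bar N$ with $1\le \bar N\le N$. Let $\Psi=U_\Psi\Lambda V_\Psi^{T}$ be an SVD of $\Psi$, where $\Lambda=\mathrm{diag}(\lambda_1,\dots,\lambda_{\bar N})$ with $\lambda_1\ge\lambda_2\ge\cdots\ge\lambda_{\bar N}>0$, and $U_\Psi\in\mathbb{R}^{N\times\bar N}$, $V_\Psi\in\mathbb{R}^{L\times\bar N}$ have orthonormal columns. Consider the two-level optimization problem $$\min_{\Phi\in\mathcal S}\ \|\Phi\|_F^2,\qquad \mathcal S=\arg\min_{\tilde\Phi\in\mathbb{R}^{M\times N}}\ \|I_L-\Psi^{T}\tilde\Phi^{T}\tilde\Phi\Psi\|_F^2 .\qquad (\ast)$$ (i) If $\bar N\ge M$, then every element of $$\mathcal W_1:=\left\{\begin{bmatrix}U_M & 0\end{bmatrix}\Lambda^{-1}U_\Psi^{T}\ :\ U_M\in\mathcal U_M\right\}$$ is an optimal solution of $(\ast)$, where $\begin{bmatrix}U_M & 0\end{bmatrix}$ is the $M\times\bar N$ matrix obtained by appending $\bar N-M$ zero columns to $U_M$. (ii) If $\bar N<M$, then every element of $$\mathcal W_2:=\left\{U_{M,\bar N}\,\Lambda^{-1}U_\Psi^{T}\ :\ U_{M,\bar N}\in\mathcal U_{M,\bar N}\right\}$$ is an optimal solution of $(\ast)$.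
   Context: $\|\cdot\|_F$ is the Frobenius norm, $I_n$ is the $n\times n$ identity matrix, and $\arg\min$ denotes the set of all global minimizers. For $n\le m$, $\mathcal U_{m,n}:=\{U\in\mathbb{R}^{m\times n}: U^{T}U=I_n\}$, and $\mathcal U_m:=\mathcal U_{m,m}$ is the set of $m\times m$ orthogonal matrices. An optimal solution of $(\ast)$ is a matrix $\Phi\in\mathcal S$ such that $\|\Phi\|_F^2\le\|\Phi'\|_F^2$ for all $\Phi'\in\mathcal S$. *)

(* Defs.v *)
From HB Require Import structures.
From mathcomp Require Import all_boot all_order all_algebra.
From mathcomp Require Import boolp classical_sets reals.

Set Implicit Arguments.
Unset Strict Implicit.
Unset Printing Implicit Defensive.

Import Order.TTheory GRing.Theory Num.Theory.

Local Open Scope classical_set_scope.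
Local Open Scope ring_scope.

Definition frobenius_norm (R : realType) (m n : nat) (A : 'M[R]_(m, n)) : R :=
  Num.sqrt (\sum_(i < m) \sum_(j < n) A i j ^+ 2).

Definition argmin (R : realType) (T : Type) (f : T -> R) (D : set T) : set T :=
  [set x | D x /\ forall y, D y -> f x <= f y].

(* Empty unless n <= m; for n = m, the orthogonal matrices. *)
Definition orthonormal_cols (R : realType) (m n : nat) : set 'M[R]_(m, n) :=
  [set U | U^T *m U = 1%:M].
Arguments orthonormal_cols : clear implicits.

(* Compact SVD with r singular values, stored in nonincreasing order as the
   row vector lam. *)
Definition is_compact_svd (R : realType) (m n r : nat) (A : 'M[R]_(m, n))
    (U : 'M[R]_(m, r)) (lam : 'rV[R]_r) (V : 'M[R]_(n, r)) : Prop :=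
  [/\ A = U *m diag_mx lam *m V^T,
      orthonormal_cols R m r U,
      orthonormal_cols R n r V,
      forall i j : 'I_r, (i <= j)%N -> lam 0 j <= lam 0 i
    & forall i : 'I_r, 0 < lam 0 i].

(* The cast identifies the width m + (n - m) of [U 0] with n. *)
Definition pad_zero_cols (R : realType) (m n : nat) (le_mn : (m <= n)%N)
    (U : 'M[R]_m) : 'M[R]_(m, n) :=
  castmx (erefl m, subnKC le_mn) (row_mx U (0 : 'M[R]_(m, n - m))).

Definition inner_minimizers (R : realType) (M N L : nat) (Psi : 'M[R]_(N, L)) :
    set 'M[R]_(M, N) :=
  argmin (fun Phi : 'M[R]_(M, N) =>
            frobenius_norm (1%:M - Psi^T *m Phi^T *m Phi *m Psi) ^+ 2) setT.
Arguments inner_minimizers {R} M {N L} Psi.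

Definition optimal_solutions (R : realType) (M N L : nat) (Psi : 'M[R]_(N, L)) :
    set 'M[R]_(M, N) :=
  argmin (fun Phi : 'M[R]_(M, N) => frobenius_norm Phi ^+ 2)
         (inner_minimizers M Psi).
Arguments optimal_solutions {R} M {N L} Psi.

Definition W1 (R : realType) (M N Nbar : nat) (le_M_Nbar : (M <= Nbar)%N)
    (U : 'M[R]_(N, Nbar)) (lam : 'rV[R]_Nbar) : set 'M[R]_(M, N) :=
  [set pad_zero_cols le_M_Nbar UM *m invmx (diag_mx lam) *m U^T
     | UM in orthonormal_cols R M M].

Definition W2 (R : realType) (M N Nbar : nat)
    (U : 'M[R]_(N, Nbar)) (lam : 'rV[R]_Nbar) : set 'M[R]_(M, N) :=
  [set UMN *m invmx (diag_mx lam) *m U^T | UMN in orthonormal_cols R M Nbar].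
Arguments W2 {R} M {N Nbar} U lam.

(* Main.v *)
(** Put [B = Phi U Lambda]. Comparing traces, the inner objective equals
    [L - M + |I - B B^T|^2] as well as [L - Nbar + |I - B^T B|^2], so its
    minimizers are the [Phi] with [B B^T = I] when [M <= Nbar] and those with
    [B^T B = I] when [Nbar < M].  Moreover
    [|Phi|^2 >= |Phi U|^2 = sum_j c_j / lam_j^2], where [c_j] is the squared norm
    of the [j]-th column of [B].  In the second case every [c_j] is [1]; in the
    first one [0 <= c_j <= 1] and [sum_j c_j = M], so the sum is least when
    [c] selects the [M] largest [lam_j]. *)
Require Import Defs.
From HB Require Import structures.
From mathcomp Require Import all_boot all_order all_algebra.
From mathcomp Require Import boolp classical_sets reals.
From mathcomp Require Import ring lra.

Set Implicit Arguments.
Unset Strict Implicit.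
Unset Printing Implicit Defensive.

Import Order.TTheory GRing.Theory Num.Theory.

Local Open Scope classical_set_scope.
Local Open Scope ring_scope.

(** * Squared Frobenius norms as traces *)

Section FrobeniusNorm.
Variable R : realType.

Lemma mxtrace_mulmx_trE m n (A : 'M[R]_(m, n)) :
  \tr (A *m A^T) = \sum_i \sum_j A i j ^+ 2.
Proof.
apply: eq_bigr => i _; rewrite mxE; apply: eq_bigr => j _.
by rewrite mxE expr2.
Qed.

Lemma mxtrace_mulmx_tr_ge0 m n (A : 'M[R]_(m, n)) : 0 <= \tr (A *m A^T).
Proof.
rewrite mxtrace_mulmx_trE.
by apply: sumr_ge0 => i _; apply: sumr_ge0 => j _; apply: sqr_ge0.
Qed.

Lemma frobenius_norm_sqr m n (A : 'M[R]_(m, n)) :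
  frobenius_norm A ^+ 2 = \tr (A *m A^T).
Proof.
by rewrite /frobenius_norm -mxtrace_mulmx_trE sqr_sqrtr ?mxtrace_mulmx_tr_ge0.
Qed.

Lemma frobenius_norm_le0_eq0 m n (A : 'M[R]_(m, n)) :
  frobenius_norm A ^+ 2 <= 0 -> A = 0.
Proof.
rewrite frobenius_norm_sqr mxtrace_mulmx_trE => A_le0.
have sum_ge0 i : 0 <= \sum_j A i j ^+ 2.
  by apply: sumr_ge0 => j _; apply: sqr_ge0.
have A_eq0 : \sum_i \sum_j A i j ^+ 2 == 0.
  by rewrite eq_le A_le0 sumr_ge0.
apply/matrixP => i j; rewrite mxE; apply/eqP; rewrite -sqrf_eq0.
move: A_eq0; rewrite psumr_eq0 => [/allP /(_ i)|//].
rewrite mem_index_enum => /(_ isT) /=; rewrite psumr_eq0 => [/allP /(_ j)|*].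
  by rewrite mem_index_enum => /(_ isT).
exact: sqr_ge0.
Qed.

Lemma frobenius_norm0 m n : frobenius_norm (0 : 'M[R]_(m, n)) ^+ 2 = 0.
Proof. by rewrite frobenius_norm_sqr mul0mx mxtrace0. Qed.

(** By cyclicity of the trace, both squared norms expand to their size minus twice the trace of
    [A *m A^T] plus the trace of its square, so only the sizes differ. *)
Lemma frobenius_norm_1sub_gram m n (A : 'M[R]_(m, n)) :
  frobenius_norm (1%:M - A^T *m A) ^+ 2
  = n%:R - m%:R + frobenius_norm (1%:M - A *m A^T) ^+ 2.
Proof.
have expand p q (B : 'M[R]_(p, q)) :
    frobenius_norm (1%:M - B^T *m B) ^+ 2
    = q%:R - \tr (B *m B^T) *+ 2 + \tr (B *m B^T *m (B *m B^T)).
  rewrite frobenius_norm_sqr linearB /= trmx1 trmx_mul trmxK.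
  rewrite mulmxBl !mulmxBr !mul1mx !mulmx1 !linearB /= mxtrace1.
  rewrite (mxtrace_mulC B^T B) -[B^T *m B *m _]mulmxA (mxtrace_mulC B^T).
  by rewrite !mulmxA mulr2n; ring.
rewrite expand -[X in 1%:M - X *m _]trmxK expand trmxK.
rewrite (mxtrace_mulC A^T A) -[A^T *m A *m _]mulmxA (mxtrace_mulC A^T).
by rewrite !mulmxA; ring.
Qed.

Lemma frobenius_norm_mul_orthonormal m n r
    (A : 'M[R]_(m, r)) (U : 'M[R]_(n, r)) :
  orthonormal_cols R n r U ->
  frobenius_norm (A *m U^T) ^+ 2 = frobenius_norm A ^+ 2.
Proof.
move=> UTU; rewrite !frobenius_norm_sqr trmx_mul trmxK.
by rewrite mulmxA -(mulmxA A) UTU mulmx1.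
Qed.

(** Pythagoras: [U *m U^T] is an orthogonal projection, and the two sides differ by the squared norm
    of [A - A *m U *m U^T]. *)
Lemma frobenius_norm_mul_orthonormal_le m n r
    (A : 'M[R]_(m, n)) (U : 'M[R]_(n, r)) :
  orthonormal_cols R n r U ->
  frobenius_norm (A *m U) ^+ 2 <= frobenius_norm A ^+ 2.
Proof.
move=> UTU; rewrite -subr_ge0 !frobenius_norm_sqr.
suff -> : \tr (A *m A^T) - \tr (A *m U *m (A *m U)^T)
    = \tr ((A - A *m U *m U^T) *m (A - A *m U *m U^T)^T).
  exact: mxtrace_mulmx_tr_ge0.
rewrite linearB /= !trmx_mul trmxK mulmxBl !mulmxBr !linearB /= !mulmxA.
by rewrite -(mulmxA (A *m U) U^T U) UTU mulmx1; ring.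
Qed.

Lemma frobenius_norm_mul_diag m n (A : 'M[R]_(m, n)) (d : 'rV[R]_n) :
  frobenius_norm (A *m diag_mx d) ^+ 2
  = \sum_j (A^T *m A) j j * d 0 j ^+ 2.
Proof.
rewrite frobenius_norm_sqr mxtrace_mulmx_trE exchange_big /=.
apply: eq_bigr => j _; rewrite mxE big_distrl /=; apply: eq_bigr => i _.
by rewrite mul_mx_diag !mxE exprMn expr2.
Qed.

End FrobeniusNorm.

(** * Diagonal inverses, Gram diagonals and weighted sums *)

Lemma invmx_diag (F : fieldType) n (d : 'rV[F]_n) :
  (forall i, d 0 i != 0) -> invmx (diag_mx d) = diag_mx (map_mx GRing.inv d).
Proof.
move=> d_neq0.
have dK : diag_mx d *m diag_mx (map_mx GRing.inv d) = 1%:M.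
  apply/matrixP => i j; rewrite mul_diag_mx !mxE.
  case: eqP => [->|_]; last by rewrite !mulr0n mulr0.
  by rewrite !mulr1n divff.
have [d_unit _] := mulmx1_unit dK.
by rewrite -[RHS](mulKmx d_unit) dK mulmx1.
Qed.

(** Here [P = B^T *m B] is symmetric and idempotent, so [P j j] is the sum of the squares in row
    [j], hence at least [P j j ^+ 2]. *)
Lemma gram_diag_bounds (R : realFieldType) m n (B : 'M[R]_(m, n)) (j : 'I_n) :
  B *m B^T = 1%:M -> 0 <= (B^T *m B) j j <= 1.
Proof.
move=> BBT; set P := B^T *m B.
have PE : P j j = \sum_k P j k ^+ 2.
  have PT k : P k j = P j k by rewrite -[P in LHS]trmxK mxE trmx_mul trmxK.
  have PP : P *m P = P by rewrite /P mulmxA -(mulmxA B^T) BBT mulmx1.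
  by rewrite -{1}PP mxE; apply: eq_bigr => k _; rewrite PT expr2.
have P_ge0 : 0 <= P j j by rewrite PE sumr_ge0 // => k _; apply: sqr_ge0.
rewrite P_ge0 /=.
have : P j j ^+ 2 <= P j j.
  rewrite {2}PE (bigD1 j) //= lerDl.
  by apply: sumr_ge0 => k _; apply: sqr_ge0.
nra.
Qed.

Lemma sum_ord_ltn (R : pzSemiRingType) m n : (m <= n)%N ->
  \sum_(j < n) (j < m)%N%:R = m%:R :> R.
Proof.
move=> le_mn; rewrite -natr_sum.
rewrite -(big_mkord xpredT (fun j => nat_of_bool (j < m)%N)).
rewrite (big_cat_nat (leq0n m) le_mn) //=.
rewrite (eq_big_nat _ _ (F2 := fun=> 1%N)) => [|j /andP[_ ->] //].
rewrite sum_nat_const_nat subn0 muln1 big1_seq ?addn0 // => j.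
by rewrite mem_index_iota => /andP[_ /andP[le_mj _]]; rewrite ltnNge le_mj.
Qed.

(** A discrete bathtub principle, meant for the weights [(lam 0 j)^-1 ^+ 2], which increase with [j]
    because [lam] decreases. *)
Lemma weighted_sum_ge (R : realFieldType) m n (w c : 'I_n -> R) :
    (0 < m <= n)%N -> {homo w : i j / (i <= j)%N >-> i <= j} ->
    (forall j, 0 <= c j <= 1) -> \sum_j c j = m%:R ->
  \sum_(j < n) (j < m)%N%:R * w j <= \sum_j c j * w j.
Proof.
move=> /andP[m_gt0 le_mn] w_homo c01 sum_c.
(* The threshold is the largest of the first [m] weights, at index [m.-1]. *)
have lt_m1n : (m.-1 < n)%N by rewrite prednK.
pose t := w (Ordinal lt_m1n).
(* Both sums have total weight m, so w may be shifted by its threshold value t. *)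
have termwise (j : 'I_n) :
    (j < m)%N%:R * w j - (j < m)%N%:R * t <= c j * w j - c j * t.
  have /andP[c_ge0 c_le1] := c01 j; rewrite -!mulrBr.
  case: ltnP => [lt_jm|le_mj].
    have : w j <= t by apply: w_homo; rewrite /= -ltnS prednK.
    rewrite mul1r; nra.
  have : t <= w j by apply: w_homo; rewrite /= (leq_trans (leq_pred m)).
  rewrite mul0r; nra.
have := ler_sum (index_enum 'I_n) (P := xpredT) (fun j _ => termwise j).
by rewrite !sumrB -!mulr_suml sum_c sum_ord_ltn // lerD2r.
Qed.

(** * Orthogonal matrices padded with zero columns *)

Section PadZeroCols.
Variables (R : realType) (m n : nat) (le_mn : (m <= n)%N) (U : 'M[R]_m).
Hypothesis U_orth : orthonormal_cols R m m U.

Lemma pad_zero_cols_mul_tr :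
  pad_zero_cols le_mn U *m (pad_zero_cols le_mn U)^T = 1%:M.
Proof.
(* With [n - m] generalized to [k], the cast runs along [m + k = n], and eliminating [n] makes it
   the identity. *)
rewrite /pad_zero_cols; move: (subnKC le_mn); move: (n - m)%N => k.
case: n / => /=; rewrite castmx_id tr_row_mx mul_row_col trmx0 mulmx0 addr0.
exact: mulmx1C.
Qed.

Lemma gram_pad_zero_cols_diag (j : 'I_n) :
  ((pad_zero_cols le_mn U)^T *m pad_zero_cols le_mn U) j j = (j < m)%N%:R.
Proof.
rewrite /pad_zero_cols; move: (subnKC le_mn); move: (n - m)%N => k e.
case: n / e j => j; rewrite castmx_id tr_row_mx mul_col_row.
rewrite U_orth trmx0 !mul0mx mulmx0 -[j]splitK.
case: (split j) => i /=.
  by rewrite block_mxEul !mxE eqxx ltn_ord.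
by rewrite block_mxEdr mxE ltnNge leq_addr.
Qed.

End PadZeroCols.

(** * Reduction through the singular value decomposition *)

Section CompactSVD.
Variables (R : realType) (M N L r : nat) (Psi : 'M[R]_(N, L)).
Variables (U : 'M[R]_(N, r)) (lam : 'rV[R]_r) (V : 'M[R]_(L, r)).
Hypothesis svd_Psi : is_compact_svd Psi U lam V.

Let B (Phi : 'M[R]_(M, N)) : 'M[R]_(M, r) := Phi *m U *m diag_mx lam.

Let lam_neq0 i : lam 0 i != 0.
Proof. by case: svd_Psi => _ _ _ _ lam_gt0; rewrite gt_eqF. Qed.

Let lam_inv := invmx_diag lam_neq0.

Let lam_unit : diag_mx lam \in unitmx.
Proof.
by rewrite unitmxE det_diag unitfE; apply/prodf_neq0 => i _.
Qed.

Lemma inner_objectiveE (Phi : 'M[R]_(M, N)) :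
  frobenius_norm (1%:M - Psi^T *m Phi^T *m Phi *m Psi) ^+ 2
  = L%:R - M%:R + frobenius_norm (1%:M - B Phi *m (B Phi)^T) ^+ 2.
Proof.
case: svd_Psi => PsiE _ VTV _ _.
rewrite -mulmxA -trmx_mul frobenius_norm_1sub_gram.
have -> : Phi *m Psi = B Phi *m V^T by rewrite PsiE /B !mulmxA.
by rewrite trmx_mul trmxK mulmxA -(mulmxA (B Phi)) VTV mulmx1.
Qed.

(** The form for [r < M]: there [B Phi *m (B Phi)^T] has rank at most [r] and cannot be the
    identity, while the Gram matrix of size [r] can. *)
Lemma inner_objective_gramE (Phi : 'M[R]_(M, N)) :
  frobenius_norm (1%:M - Psi^T *m Phi^T *m Phi *m Psi) ^+ 2
  = L%:R - r%:R + frobenius_norm (1%:M - (B Phi)^T *m B Phi) ^+ 2.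
Proof. by rewrite inner_objectiveE frobenius_norm_1sub_gram; ring. Qed.

Lemma frobenius_norm_ge_weighted (Phi : 'M[R]_(M, N)) :
  \sum_j ((B Phi)^T *m B Phi) j j * (lam 0 j)^-1 ^+ 2 <= frobenius_norm Phi ^+ 2.
Proof.
case: svd_Psi => _ UTU _ _ _.
apply: le_trans (frobenius_norm_mul_orthonormal_le Phi UTU).
rewrite -[Phi *m U](mulmxK lam_unit) -/(B Phi) lam_inv frobenius_norm_mul_diag.
by under [leRHS]eq_bigr do rewrite [in X in _ * X]mxE.
Qed.

Section Candidate.
Variable X : 'M[R]_(M, r).

(** The preimage of [X] under [B] whose rows lie in the column space of [U]; it attains equality in
    [frobenius_norm_ge_weighted]. *)
Let cand := X *m invmx (diag_mx lam) *m U^T.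

Let B_cand : B cand = X.
Proof.
case: svd_Psi => _ UTU _ _ _.
by rewrite /B /cand -(mulmxA _ U^T) UTU mulmx1 mulmxKV.
Qed.

Let frobenius_norm_cand :
  frobenius_norm cand ^+ 2 = \sum_j (X^T *m X) j j * (lam 0 j)^-1 ^+ 2.
Proof.
case: svd_Psi => _ UTU _ _ _.
rewrite frobenius_norm_mul_orthonormal // lam_inv frobenius_norm_mul_diag.
by under eq_bigr do rewrite [in X in _ * X]mxE.
Qed.

Lemma optimal_of_gram_diag :
    (0 < M <= r)%N -> X *m X^T = 1%:M ->
    (forall j, (X^T *m X) j j = (j < M)%N%:R) ->
  optimal_solutions M Psi cand.
Proof.
move=> M_bounds XXT XTX.
have cand_inner : frobenius_norm (1%:M - B cand *m (B cand)^T) ^+ 2 = 0.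
  by rewrite B_cand XXT subrr frobenius_norm0.
split=> [|Phi [_ /(_ cand I)]].
  by split=> // Phi _; rewrite !inner_objectiveE cand_inner lerD2l sqr_ge0.
(* The residual of [cand] is zero, so that of any inner minimizer [Phi] vanishes too. *)
rewrite !inner_objectiveE cand_inner lerD2l => /frobenius_norm_le0_eq0/eqP.
rewrite subr_eq0 eq_sym => /eqP BBT.
apply: le_trans (frobenius_norm_ge_weighted Phi).
rewrite frobenius_norm_cand; under eq_bigr do rewrite XTX.
apply: weighted_sum_ge => // [i j le_ij|j|].
- case: svd_Psi => _ _ _ lam_homo lam_gt0.
  rewrite ler_sqr ?nnegrE ?invr_ge0 ?(ltW (lam_gt0 _)) //.
  by rewrite lef_pV2 ?posrE ?lam_homo.
- exact: gram_diag_bounds.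
- by rewrite -/(mxtrace _) mxtrace_mulC BBT mxtrace1.
Qed.

Lemma optimal_of_orthonormal :
  orthonormal_cols R M r X -> optimal_solutions M Psi cand.
Proof.
move=> XTX.
have cand_inner : frobenius_norm (1%:M - (B cand)^T *m B cand) ^+ 2 = 0.
  by rewrite B_cand XTX subrr frobenius_norm0.
split=> [|Phi [_ /(_ cand I)]].
  by split=> // Phi _; rewrite !inner_objective_gramE cand_inner lerD2l sqr_ge0.
rewrite !inner_objective_gramE cand_inner lerD2l => /frobenius_norm_le0_eq0/eqP.
rewrite subr_eq0 eq_sym => /eqP BTB.
(* Both Gram matrices are the identity, so the lower bound for [Phi] is exactly the squared norm of
   [cand]. *)
by rewrite frobenius_norm_cand XTX -BTB frobenius_norm_ge_weighted.
Qed.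

End Candidate.
End CompactSVD.

Theorem theorem1 (R : realType) (M N L Nbar : nat)
    (M_gt0 : (0 < M)%N) (N_gt0 : (0 < N)%N) (L_gt0 : (0 < L)%N)
    (Nbar_bounds : (1 <= Nbar <= N)%N)
    (Psi : 'M[R]_(N, L)) (rank_Psi : \rank Psi = Nbar)
    (UPsi : 'M[R]_(N, Nbar)) (lam : 'rV[R]_Nbar) (VPsi : 'M[R]_(L, Nbar))
    (svd_Psi : is_compact_svd Psi UPsi lam VPsi) :
  (forall le_M_Nbar : (M <= Nbar)%N,
     W1 le_M_Nbar UPsi lam `<=` optimal_solutions M Psi)
  /\ ((Nbar < M)%N -> W2 M UPsi lam `<=` optimal_solutions M Psi).
Proof.
split=> [le_M_Nbar|_] Phi [X X_orth <-].
  apply: (optimal_of_gram_diag svd_Psi); rewrite ?M_gt0 //.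
    exact: pad_zero_cols_mul_tr.
  exact: gram_pad_zero_cols_diag.
exact: (optimal_of_orthonormal svd_Psi).
Qed.
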